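(* The communication complexity of constructing a $3$-spanner of an unweighted undirected distributed graph on $n$ vertices with edges observed at $s$ sites in the blackboard model, with or without duplication, is $\tilde{O}(s+n\sqrt{n+s})$.
   Context: Distributed graph: there are $s$ sites $S_1,\dots,S_s$; all know the common vertex set $V$, $|V|=n$, and site $S_i$ holds a subset $E_i\subseteq E$ of the edges of an undirected graph $G=(V,E)$, where $E=\bigcup_{i=1}^s E_i$. In the setting without duplication the sets $E_i$ are pairwise disjoint; in the duplication setting they may intersect. Blackboard model: sites communicate by writing messages on a shared blackboard (a broadcast channel) visible to all sites and to a coordinator, who must output the result. The communication cost of a protocol is the total number of bits communicated; the communication complexity of a problem is the least communication cost of a (randomized, with success probability $1-o(1)$) protocol solving it. Spanner: a $3$-spanner of $G$ is a subgraph $H=(V,E')$, $E'\subseteq E$, with $d_H(u,v)\le 3\,d_G(u,v)$ for all $u,v\in V$, where $d$ denotes shortest-path distance. $\tilde{O}(f)$ denotes $f$ times a polylogarithmic factor (in $n$ and $s$). *)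

(* Defs.v *)
From HB Require Import structures.
From mathcomp Require Import all_boot all_order all_algebra.
From mathcomp Require Import all_classical all_reals all_analysis.
Import Order.TTheory GRing.Theory Num.Theory.
Import numFieldNormedType.Exports.

Set Implicit Arguments.
Unset Strict Implicit.
Unset Printing Implicit Defensive.

Local Open Scope ring_scope.

Section Graphs.
Variables (R : realType) (n : nat).

(* An edge set is a set of unordered pairs of vertices; the condition that
   every element has cardinal 2 (no loops) is imposed in [valid_instance]. *)
Definition edge_set := {set {set 'I_n}}.

Definition adj (E : edge_set) : rel 'I_n :=
  fun u v => [set u; v]%SET \in E.

(* Shortest-path distance; +oo when u and v are not connected. *)
Definition dist (E : edge_set) (u v : 'I_n) : \bar R :=
  ereal_inf [set (size p)%:R%:E | p in
    [set p : seq 'I_n | path (adj E) u p /\ last u p = v]]%classic.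

Definition is_spanner (t : nat) (E H : edge_set) : Prop :=
  H \subset E /\
  forall u v : 'I_n, (dist H u v <= t%:R%:E * dist E u v)%E.

End Graphs.

Section Blackboard.
Variables (n s : nat).

Definition instance := {ffun 'I_s -> edge_set n}.

Definition whole_graph (E : instance) : edge_set n :=
  (\bigcup_(i < s) E i)%SET.

(* [dup = true]: the E_i may intersect; [dup = false]: they are pairwise
   disjoint. *)
Definition valid_instance (dup : bool) : pred instance := fun E =>
  [forall i, forall e in E i, #|e| == 2] &&
  (dup || [forall i, forall j, (i != j) ==> [disjoint E i & E j]]).

Section Protocols.
Variable r : nat.

(* Private coins: independent uniform r-bit strings, one per site [Some i] and
   one for the coordinator [None]. *)
Definition coins := {ffun option 'I_s -> r.-tuple bool}.

(* Protocol tree.  The position in the tree is the current content of the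
   blackboard: it determines which site writes the next bit, and that bit may
   depend on it, on the edges held by the site, and on the site's own coins.
   At a leaf the coordinator outputs an edge set, which depends only on the
   blackboard and on the coordinator's coins. *)
Inductive protocol : Type :=
| Output of (r.-tuple bool -> edge_set n)
| Write (i : 'I_s) of (edge_set n -> r.-tuple bool -> bool)
                    & (bool -> protocol).

Fixpoint run (P : protocol) (E : instance) (w : coins) :
    seq bool * edge_set n :=
  match P with
  | Output out => ([::], out (w None))
  | Write i bit next =>
      let b := bit (E i) (w (Some i)) in
      let: (board, H) := run (next b) E w in
      (b :: board, H)
  end.

Definition blackboard P E w := (run P E w).1.
Definition output P E w := (run P E w).2.

Definition cost (dup : bool) (P : protocol) : nat :=
  \max_(E : instance | valid_instance dup E)
    \max_(w : coins) size (blackboard P E w).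

Definition success_probability (R : realType) (t : nat) (P : protocol)
    (E : instance) : R :=
  #|[pred w : coins | `[< is_spanner R t (whole_graph E) (output P E w) >]]|%:R
  / #|coins|%:R.

Definition solves_spanner (R : realType) (t : nat) (dup : bool) (err : R)
    (P : protocol) : Prop :=
  forall E : instance, valid_instance dup E ->
    1 - err <= success_probability R t P E.

End Protocols.

(* Least cost of a protocol with error at most err; +oo if there is none. *)
Definition spanner_complexity (R : realType) (t : nat) (dup : bool) (err : R) :
    \bar R :=
  ereal_inf [set c%:R%:E | c in
    [set c : nat | exists (r : nat) (P : protocol r),
       solves_spanner t dup err P /\ cost dup P = c]]%classic.

End Blackboard.

(* g is f times a polylogarithmic factor in n and s, uniformly in both. *)
Definition is_tildeO (R : realType) (g : nat -> nat -> \bar R)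
    (f : nat -> nat -> R) : Prop :=
  exists (C : R) (k : nat), forall n s : nat, (0 < n)%N -> (0 < s)%N ->
    (g n s <= (C * f n s * ln (n + s)%:R ^+ k)%:E)%E.

(* Main.v *)
(** The sites speak in turn and grow a common edge set [H] greedily: a site adds
    an edge [uv] of its own as long as [H] contains no walk of length exactly 3
    from [u] to [v], and then passes.  Adding such an edge never closes a 4-cycle,
    so [H] stays C4-free and has O(n^(3/2)) edges, whatever the order and the
    duplication of the edges.  Hence O(s + n^(3/2)) messages of O(log n) bits
    suffice, deterministically and without error.  In the end every edge of the
    graph is replaced by a walk of length 3 in [H]. *)
Require Import Defs.
From HB Require Import structures.
From mathcomp Require Import all_boot all_order all_algebra.
From mathcomp Require Import all_classical all_reals all_analysis.
From mathcomp Require Import zify ring lra.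
Import Order.TTheory GRing.Theory Num.Theory.
Import numFieldNormedType.Exports.
Set Implicit Arguments.
Unset Strict Implicit.
Unset Printing Implicit Defensive.

Local Open Scope ring_scope.
Local Open Scope classical_set_scope.

(** * Walks of length 3 and 4-cycles *)

Section C4Free.
Variable n : nat.
Implicit Types (E H : edge_set n) (u v a b x y : 'I_n).

Definition loopless H := forall u, ~~ adj H u u.

(** Vertices may repeat: an edge uv of [H] gives the walk u, v, u, v, so the edges of [H] are
    themselves covered. *)
Definition walk3 H u v := [exists x, exists y, [&& adj H u x, adj H x y & adj H y v]].

(** The pairs a, b and x, y are opposite corners; in a loopless graph the four vertices are then
    distinct. *)
Definition c4free H := forall a b x y, a != b -> x != y ->
  ~~ [&& adj H a x, adj H x b, adj H b y & adj H y a].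

Lemma adj_sym H u v : adj H u v = adj H v u.
Proof. by rewrite /adj finset.setUC. Qed.

Lemma adj_sub E H u v : E \subset H -> adj E u v -> adj H u v.
Proof. by move=> /fintype.subsetP; apply. Qed.

Lemma walk3_sub E H u v : E \subset H -> walk3 E u v -> walk3 H u v.
Proof.
move=> sEH /existsP[x /existsP[y /and3P[ux xy yv]]].
by apply/existsP; exists x; apply/existsP; exists y; rewrite !(adj_sub sEH).
Qed.

Lemma adj_walk3 H u v : adj H u v -> walk3 H u v.
Proof.
by move=> uv; apply/existsP; exists v; apply/existsP; exists u; rewrite uv adj_sym uv.
Qed.

Lemma walk3_sym H u v : walk3 H u v = walk3 H v u.
Proof.
by apply/idP/idP => /existsP[x /existsP[y /and3P[ux xy yv]]];
  apply/existsP; exists y; apply/existsP; exists x;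
  rewrite adj_sym yv adj_sym xy adj_sym ux.
Qed.

Lemma set2_eq u v x y : ([set u; v] == [set x; y])%SET ->
  (u = x /\ v = y) \/ (u = y /\ v = x).
Proof.
move=> /eqP e.
have : u \in [set x; y]%SET by rewrite -e finset.set21.
have : v \in [set x; y]%SET by rewrite -e finset.set22.
have : x \in [set u; v]%SET by rewrite e finset.set21.
have : y \in [set u; v]%SET by rewrite e finset.set22.
rewrite !finset.in_set2.
by do 4![case/orP => /eqP ?]; subst; auto.
Qed.

Lemma adj_add H u v x y : adj ([set u; v]%SET |: H)%SET x y ->
  adj H x y \/ (x = u /\ y = v) \/ (x = v /\ y = u).
Proof.
by rewrite /adj finset.in_setU1 => /orP[/set2_eq|]; [right|left].
Qed.

(** If exactly one side of a 4-cycle is new, the other three form a walk of length 3 joining u and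
    v. Two or more new sides force two opposite corners to coincide, u = v, or a loop in [H]. *)
Lemma c4free_add H u v : loopless H -> u != v -> ~~ walk3 H u v ->
  c4free H -> c4free ([set u; v]%SET |: H)%SET.
Proof.
move=> lH /eqP uv W cH a b x y ab xy; apply/negP => /and4P[].
have W' : ~~ walk3 H v u by rewrite walk3_sym.
have w p q c d : adj H p c -> adj H c d -> adj H d q -> walk3 H p q.
  by move=> h1 h2 h3; apply/existsP; exists c; apply/existsP; exists d; rewrite h1 h2.
have lp p : adj H p p -> False by apply/negP.
move: (cH a b x y ab xy) => /negP nC.
move/eqP: ab => ab; move/eqP: xy => xy.
have wu c d : adj H u c -> adj H c d -> adj H d v -> False.
  by move=> h1 h2 h3; move/negP: W; apply; apply: w h1 h2 h3.
have wv c d : adj H v c -> adj H c d -> adj H d u -> False.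
  by move=> h1 h2 h3; move/negP: W'; apply; apply: w h1 h2 h3.
move=> /adj_add[h1|[[? ?]|[? ?]]] /adj_add[h2|[[? ?]|[? ?]]]
       /adj_add[h3|[[? ?]|[? ?]]] /adj_add[h4|[[? ?]|[? ?]]];
  subst; try congruence; try (by apply: nC; rewrite h1 h2 h3 h4);
  by [apply: wu; eassumption | apply: wv; eassumption].
Qed.

(** * The O(n^(3/2)) edge bound for C4-free graphs *)

Lemma sum_nat_sqr (d : 'I_n -> nat) :
  ((\sum_i d i) ^ 2 <= n * \sum_i d i ^ 2)%N.
Proof.
(* Cauchy-Schwarz: once doubled, both sides are sums over i and j, compared termwise by 2ab <= a^2 +
   b^2. *)
rewrite -(leq_pmul2l (isT : (0 < 2)%N)).
have -> : ((\sum_i d i) ^ 2 = \sum_i \sum_j d i * d j)%N.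
  by rewrite -mulnn big_distrl; apply: eq_bigr => i _; rewrite big_distrr.
have -> : (2 * (n * \sum_i d i ^ 2) = \sum_(i < n) \sum_(j < n) (d i ^ 2 + d j ^ 2))%N.
  under [RHS]eq_bigr do rewrite big_split /= sum_nat_const card_ord.
  by rewrite big_split /= -big_distrr /= sum_nat_const card_ord mul2n addnn.
rewrite big_distrr leq_sum //= => i _; rewrite big_distrr leq_sum //= => j _.
exact: nat_Cauchy.
Qed.

(** Edges are counted as ordered pairs, so that the degrees sum to exactly this number. *)
Definition arcs H := #|[set p : 'I_n * 'I_n | adj H p.1 p.2]%SET|.

Definition degree H v := #|[set u | adj H v u]%SET|.

Lemma arcsE H : arcs H = (\sum_v degree H v)%N.
Proof.
rewrite /arcs -sum1_card (eq_bigl (fun p : 'I_n * 'I_n => true && adj H p.1 p.2)); last first.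
  by move=> p; rewrite inE.
rewrite -(pair_big_dep xpredT (adj H) (fun _ _ => 1%N)) /=.
by apply: eq_bigr => v _; rewrite /degree -sum1_card; apply: eq_bigl => u; rewrite inE.
Qed.

(* Counting pairs of neighbours: distinct ones determine their midpoint. *)
Lemma c4free_sum_sqr H : c4free H ->
  (\sum_v degree H v ^ 2 <= arcs H + n ^ 2)%N.
Proof.
move=> cH.
have -> : (\sum_v degree H v ^ 2 =
    \sum_a \sum_b \sum_v (adj H v a && adj H v b))%N.
  under [RHS]eq_bigr do rewrite exchange_big.
  rewrite [RHS]exchange_big /=; apply: eq_bigr => v _.
  have -> : degree H v = (\sum_a adj H v a)%N.
    rewrite /degree -sum1_card big_mkcond; apply: eq_bigr => a _.
    by rewrite inE; case: (adj H v a).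
  rewrite -mulnn big_distrl /=; apply: eq_bigr => a _.
  by rewrite big_distrr /=; apply: eq_bigr => b _; rewrite mulnb.
have -> : (arcs H + n ^ 2 = \sum_a \sum_(b < n) ((a == b) * degree H a + 1))%N.
  have -> : (n ^ 2 = \sum_(a < n) n)%N by rewrite sum_nat_const card_ord.
  rewrite arcsE -big_split /=.
  apply: eq_bigr => a _; rewrite big_split /= sum1_card card_ord; congr addn.
  rewrite (bigD1 a) //= eqxx mul1n big1 ?addn0 // => b /negPf.
  by rewrite eq_sym => ->.
apply: leq_sum => a _; apply: leq_sum => b _.
have [<-|ab] := eqVneq a b.
  rewrite mul1n (leq_trans _ (leq_addr _ _)) //.
  rewrite /degree -sum1_card [leqRHS]big_mkcond; apply: leq_sum => v _.
  by rewrite inE andbb adj_sym; case: (adj H a v).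
rewrite mul0n add0n.
case: (pickP (fun v => adj H v a && adj H v b)) => [v /andP[va vb]|none]; last first.
  by rewrite big1 // => v _; rewrite none.
rewrite (bigD1 v) //= big1 ?addn0 ?leq_b1 // => x xv.
(* Two common neighbours x, v of a and b would close the cycle a, x, b, v. *)
apply/eqP; rewrite eqb0; apply: contra (cH a b x v ab xv) => /andP[xa xb].
by rewrite adj_sym xa xb adj_sym vb va.
Qed.

Lemma c4free_arcs H : c4free H -> (arcs H ^ 2 <= n * (arcs H + n ^ 2))%N.
Proof.
move=> cH; rewrite {1}arcsE (leq_trans (sum_nat_sqr _)) // leq_mul2l.
by rewrite c4free_sum_sqr ?orbT.
Qed.

Lemma card_le_arcs H : (forall e : {set 'I_n}, e \in H -> #|e| = 2%N) -> (#|H| <= arcs H)%N.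
Proof.
move=> H2; rewrite /arcs.
apply: leq_trans (leq_imset_card (fun p => [set p.1; p.2]%SET) _).
apply/subset_leq_card/fintype.subsetP => e eH.
have /eqP/cards2P[u [v [_ eE]]] := H2 e eH.
by apply/imsetP; exists (u, v); rewrite ?inE /adj -?eE.
Qed.

Lemma c4free_card (R : realType) H : (forall e : {set 'I_n}, e \in H -> #|e| = 2%N) -> c4free H ->
  #|H|%:R <= 2 * (n%:R * Num.sqrt n%:R) :> R.
Proof.
move=> H2 cH; have := card_le_arcs H2; rewrite -(ler_nat R) => /le_trans; apply.
have := c4free_arcs cH; rewrite -(ler_nat R) natrX natrM natrD natrX.
set D : R := (arcs H)%:R; set q := Num.sqrt n%:R => hD.
have q0 : 0 <= q by exact: sqrtr_ge0.
have qn : n%:R = q ^+ 2 by rewrite sqr_sqrtr.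
have [n0|n_gt0] := posnP n.
  by move: hD; rewrite n0 !mul0r mulr0 => hD; nra.
have q1 : 1 <= q by rewrite -sqrtr1 ler_wsqrtr // ler1n.
rewrite qn in hD *.
(* If D > 2q^3, then q^2 D <= q^3 D < D^2/2, using q >= 1, and q^6 < D^2/4, against D^2 <= q^2 D +
   q^6. *)
have [//|lt] := leP D (2 * (q ^+ 2 * q)).
have q3 : q ^+ 2 <= q ^+ 2 * q by rewrite ler_peMr // exprn_ge0.
have q3' : 0 <= q ^+ 2 by exact: exprn_ge0.
nra.
Qed.

End C4Free.

Lemma walk3_spanner (R : realType) (n : nat) (E H : edge_set n) :
  H \subset E -> (forall u v, adj E u v -> walk3 H u v) -> is_spanner R 3 E H.
Proof.
move=> sHE EW; split=> // u v.
(* With the factor 3 moved to the left, the infimum is bounded one path at a time, which also covers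
   infinite distances. *)
rewrite -lee_pdivrMl //; apply: le_ereal_inf_tmp => _ [p [pE pv] <-].
rewrite lee_pdivrMl // -EFinM -natrM.
have [q qH [qv <-]] : exists2 q, path (adj H) u q &
    last u q = v /\ size q = (3 * size p)%N.
  elim: p u pE pv => [|x p IH] u /=; first by exists [::].
  move=> /andP[/EW/existsP[a /existsP[b /and3P[ua ab bx]]] pE] /(IH x pE)[q qH [qv sq]].
  by exists [:: a, b, x & q]; rewrite /= ?ua ?ab ?bx ?qv ?sq ?mulnS.
by apply: ereal_inf_lbound; exists q.
Qed.

(** * Fixed-length messages written bit by bit *)

Section Messages.
Variable T : finType.

Definition code_length := up_log 2 #|T|.

(** The all-false default is never reached, since #|T| <= 2 ^ [code_length]. *)
Definition encode (x : T) : code_length.-tuple bool :=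
  nth [tuple of nseq _ false] (enum [set: code_length.-tuple bool]%SET) (enum_rank x).

(** Strings outside the code still label branches of the protocol tree; they are read as [x0]. *)
Definition decode (x0 : T) (c : seq bool) : T :=
  odflt x0 [pick x | encode x == c :> seq bool].

Lemma encode_inj : injective encode.
Proof.
have sz (x : T) : (enum_rank x < size (enum [set: code_length.-tuple bool]%SET))%N.
  rewrite -cardE cardsT card_tuple card_bool.
  by apply: leq_trans (ltn_ord _) _; rewrite up_logP.
move=> x y /eqP; rewrite nth_uniq ?enum_uniq // => /eqP exy.
by apply: enum_rank_inj; apply: val_inj.
Qed.

Lemma encodeK x0 : cancel encode (decode x0).
Proof.
move=> x; rewrite /decode; case: pickP => [y /eqP/val_inj/encode_inj //|].
by move=> /(_ x); rewrite eqxx.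
Qed.

Variables (n s r : nat) (x0 : T).
Implicit Types (i : 'I_s) (E : instance n s) (w : coins s r).

(** The tree is fixed before the input is known, so the message [m] is a function of the site's
    edges, and [next] receives the bits read off the branch. *)
Fixpoint send_bits i (m : edge_set n -> seq bool) k
    (next : seq bool -> protocol n s r) : protocol n s r :=
  if k is k'.+1 then
    Write i (fun F _ => head false (m F))
      (fun b => send_bits i (behead \o m) k' (fun c => next (b :: c)))
  else next [::].

Definition send i (f : edge_set n -> T) (next : T -> protocol n s r) :=
  send_bits i (fun F => encode (f F)) code_length (fun c => next (decode x0 c)).

Lemma run_send_bits i m k next E w : size (m (E i)) = k ->
  run (send_bits i m k next) E w =
    (m (E i) ++ (run (next (m (E i))) E w).1, (run (next (m (E i))) E w).2).
Proof.
elim: k m next => [|k IH] m next /= sz.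
  by rewrite (size0nil sz) /= -surjective_pairing.
rewrite IH /=; last by rewrite size_behead sz.
by case: (m (E i)) sz.
Qed.

Lemma output_send i f next E w :
  output (send i f next) E w = output (next (f (E i))) E w.
Proof. by rewrite /output run_send_bits ?size_tuple //= encodeK. Qed.

Lemma size_blackboard_send i f next E w :
  size (blackboard (send i f next) E w) =
    (code_length + size (blackboard (next (f (E i))) E w))%N.
Proof.
by rewrite /blackboard run_send_bits ?size_tuple //= size_cat size_tuple encodeK.
Qed.

End Messages.

(** * The greedy protocol and its correctness *)

Section Greedy.
Variables (n s r B : nat).
Implicit Types (E : instance n s) (H : edge_set n) (w : coins s r).

Definition uncovered H (F : edge_set n) : option ('I_n * 'I_n) :=
  [pick p | ([set p.1; p.2]%SET \in F) && ~~ walk3 H p.1 p.2].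

(* [N] bounds the number of messages; a site passes by sending [None]. *)
Fixpoint greedy N (sites : seq 'I_s) H : protocol n s r :=
  match N, sites with
  | N'.+1, i :: sites' =>
      send None i (uncovered H) (fun msg =>
        if msg is Some p then greedy N' sites ([set p.1; p.2]%SET |: H)%SET
        else greedy N' sites' H)
  | _, _ => Output s (fun _ => H)
  end.

Lemma size_greedy N sites H E w :
  (size (blackboard (greedy N sites H) E w) <=
     N * code_length (option ('I_n * 'I_n)))%N.
Proof.
elim: N sites H => [|N IH] [|i sites] H //=.
rewrite size_blackboard_send mulSn leq_add2l.
by case: (uncovered _ _) => [p|]; exact: IH.
Qed.

Lemma cost_greedy dup N sites H :
  (cost dup (greedy N sites H) <= N * code_length (option ('I_n * 'I_n)))%N.
Proof.
by apply/bigmax_leqP => E _; apply/bigmax_leqP => w _; exact: size_greedy.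
Qed.

Hypothesis c4free_le_B : forall H,
  (forall e : {set 'I_n}, e \in H -> #|e| = 2%N) -> c4free H -> (#|H| <= B)%N.

(** Each message lowers [N] by one and either enlarges [H] by one edge or retires a site, so the
    size inequality persists. Running out of messages with a site left would give #|H| > [B],
    impossible for a C4-free [H]. *)
Lemma greedyP N sites H E w :
    (forall e : {set 'I_n}, e \in whole_graph E -> #|e| = 2%N) ->
    H \subset whole_graph E -> c4free H -> (size sites + B <= N + #|H|)%N ->
  let H' := output (greedy N sites H) E w in
  [/\ H \subset H', H' \subset whole_graph E &
      forall i u v, i \in sites -> adj (E i) u v -> walk3 H' u v].
Proof.
move=> E2; elim: N sites H => [|N IH] [|i sites] H sHE cH sz /=; try by split.
  have := c4free_le_B (fun e eH => E2 e (fintype.subsetP sHE e eH)) cH.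
  by move: sz; rewrite /=; lia.
rewrite output_send; rewrite /uncovered; case: pickP => [[u v] /= /andP[uvE nW]|cov].
  have uvG : [set u; v]%SET \in whole_graph E by apply/bigcupP; exists i.
  have uv : u != v.
    by move: (E2 _ uvG); rewrite cards2; case: (u != v).
  have lH : loopless H.
    by move=> x; apply/negP => /(fintype.subsetP sHE)/E2; rewrite cards2 eqxx.
  (* The added edge is really new, so #|H| grows by exactly one. *)
  have uvH : [set u; v]%SET \notin H.
    by apply: contra nW; exact: adj_walk3.
  have sH1 : ([set u; v]%SET |: H)%SET \subset whole_graph E.
    by rewrite finset.subUset finset.sub1set uvG.
  have [|sH1' ? ?] := IH (i :: sites) _ sH1 (c4free_add lH uv nW cH).
    by rewrite cardsU1 uvH; move: sz => /=; lia.
  split=> //; apply: fintype.subset_trans sH1'; exact: finset.subsetUr.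
have [|sHH' sH'E W] := IH sites H sHE cH; first by move: sz => /=; lia.
split=> // j u v; rewrite inE => /orP[/eqP->|]; last exact: W.
(* A site that has passed stays satisfied, because walks survive as [H] grows. *)
move=> uv; apply: walk3_sub sHH' _.
by move: (cov (u, v)); rewrite /= -/(adj (E i) u v) uv /= => /negbFE.
Qed.

Lemma greedy_solves (R : realType) dup :
  solves_spanner 3 dup (0 : R) (greedy (s + B) (enum 'I_s) finset.set0).
Proof.
move=> E /andP[/'forall_forall_inP E2 _].
have G2 (e : {set 'I_n}) : e \in whole_graph E -> #|e| = 2%N.
  by move=> /bigcupP[i _ /(E2 i)/eqP].
rewrite subr0 /success_probability; set p := [pred w | _].
have -> : #|p| = #|coins s r|.
  apply: eq_card => w; rewrite !inE; apply/asboolP.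
  have [|||_ sG W] := @greedyP (s + B) (enum 'I_s) finset.set0 E w G2.
  - exact: finset.sub0set.
  - by move=> a b x y _ _; rewrite /adj finset.in_set0.
  - by rewrite size_enum_ord leq_addr.
  apply: walk3_spanner => // u v /bigcupP[i _]; apply: W.
  by rewrite mem_enum.
(* All coins succeed, and there is at least one coin outcome, so the ratio is 1. *)
rewrite divff // pnatr_eq0 -lt0n; apply/card_gt0P.
by exists [ffun => [tuple of nseq r false]].
Qed.

End Greedy.

(** * Message length and total cost *)

Lemma code_length_le (R : realType) (n s : nat) : (0 < n)%N -> (0 < s)%N ->
  (code_length (option ('I_n * 'I_n)))%:R <= 3 / ln 2 * ln (n + s)%:R :> R.
Proof.
move=> n0 s0; rewrite /code_length card_option card_prod card_ord.
have ln2 : 0 < ln 2 :> R by rewrite ln_gt0 // ltr1n.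
have le2 : ln 2 <= ln (n + s)%:R :> R.
  by rewrite ler_ln ?posrE ?ltr0n ?ler_nat; lia.
rewrite -(ler_pM2r ln2) mulrAC divfK ?gt_eqF //.
have n1 : (1 < (n * n).+1)%N by rewrite ltnS muln_gt0 n0.
have /andP[k1 _] := up_log_bounds (isT : (1 < 2)%N) n1.
move: k1; set k := up_log _ _ => k1.
(* From 2^(k-1) <= n^2 <= (n+s)^2 come two of the three logarithms; the third pays for rounding up,
   as n + s >= 2. *)
have : ln (2 ^+ k.-1) <= ln ((n + s)%:R ^+ 2) :> R.
  rewrite ler_ln ?posrE ?exprn_gt0 ?ltr0n ?addn_gt0 ?n0 // -!natrX ler_nat.
  by rewrite -ltnS (leq_trans k1) // -mulnn; nia.
rewrite !lnXn ?ltr0n ?addn_gt0 ?n0 // -![ln _ *+ _]mulr_natl => le_ln.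
have le_k : k%:R <= k.-1%:R + 1 :> R by rewrite natr1 ler_nat leqSpred.
rewrite (le_trans (ler_wpM2r (ltW ln2) le_k)) // mulrDl mul1r.
lra.
Qed.

Theorem corollary1 (R : realType) (dup : bool) :
  exists err : nat -> R, err @ \oo --> (0 : R) /\
    is_tildeO
      (fun n s : nat => spanner_complexity n s 3 dup (err n))
      (fun n s : nat => s%:R + n%:R * Num.sqrt (n + s)%:R).
Proof.
exists (fun=> 0); split; first exact: cvg_cst.
(* The 2 comes from the edge bound and the 3 / ln 2 from the message length. *)
exists (2 * (3 / ln 2)), 1%N => n s n0 s0.
pose b : R := 2 * (n%:R * Num.sqrt n%:R).
have b0 : 0 <= b by rewrite !mulr_ge0 ?sqrtr_ge0.
have leB (H : edge_set n) : (forall e : {set 'I_n}, e \in H -> #|e| = 2%N) -> c4free H ->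
    (#|H| <= Num.truncn b)%N.
  by move=> H2 cH; rewrite truncn_ge_nat // c4free_card.
pose P := @greedy n s 0 (s + Num.truncn b) (enum 'I_s) finset.set0.
apply: (@le_trans _ _ (cost dup P)%:R%:E).
  apply: ereal_inf_lbound; exists (cost dup P) => //.
  by exists 0%N, P; split=> //; exact: greedy_solves.
rewrite lee_fin expr1.
have := @cost_greedy n s 0 dup (s + Num.truncn b) (enum 'I_s) finset.set0.
rewrite -(ler_nat R) => /le_trans; apply.
have tb : (Num.truncn b)%:R <= b by rewrite truncn_le.
have sq : n%:R * Num.sqrt n%:R <= n%:R * Num.sqrt (n + s)%:R :> R.
  by rewrite ler_wpM2l // ler_wsqrtr // ler_nat leq_addr.
have -> : 2 * (3 / ln 2) * (s%:R + n%:R * Num.sqrt (n + s)%:R) * ln (n + s)%:R =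
    (2 * (s%:R + n%:R * Num.sqrt (n + s)%:R)) * (3 / ln 2 * ln (n + s)%:R) :> R.
  by ring.
rewrite natrM ler_pM ?code_length_le // natrD.
by have := ler0n R s; move: tb; rewrite /b; lra.
Qed.
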